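(* Let $m\ge 2$, $n\ge 1$, let $\mathcal{A}\in T_{m,n}$ be strictly semi-positive, let $q\in\mathbb{R}^n$, and let $x$ be a solution of TCP$(\mathcal{A},q)$. Then: (i) $\dfrac{\|(-q)_+\|_\infty}{n^{\frac{m-2}{2}}\|T_{\mathcal{A}}\|_\infty}\le\|x\|_\infty^{m-1}$; (ii) $\dfrac{\|(-q)_+\|_\infty}{\|F_{\mathcal{A}}\|_\infty^{m-1}}\le\|x\|_\infty^{m-1}$ if $m$ is even; (iii) $\dfrac{\|(-q)_+\|_2}{\|T_{\mathcal{A}}\|_2}\le\|x\|_2^{m-1}$; (iv) $\dfrac{\|(-q)_+\|_m}{\|F_{\mathcal{A}}\|_m^{m-1}}\le\|x\|_m^{m-1}$ if $m$ is even.
   Context: $T_{m,n}$ is the set of real tensors $\mathcal{A}=(a_{i_1\cdots i_m})$ of order $m$ and dimension $n$, with indices in $I_n=\{1,\dots,n\}$ and no symmetry assumed. For $x\in\mathbb{R}^n$, $\mathcal{A}x^{m-1}\in\mathbb{R}^n$ has components $(\mathcal{A}x^{m-1})_i=\sum_{i_2,\dots,i_m=1}^n a_{ii_2\cdots i_m}x_{i_2}\cdots x_{i_m}$. Inequalities between vectors are componentwise. $\mathcal{A}$ is strictly semi-positive if for each $x\ge 0$, $x\ne 0$, there is $k\in I_n$ with $x_k>0$ and $(\mathcal{A}x^{m-1})_k>0$. A solution of the tensor complementarity problem TCP$(\mathcal{A},q)$ is a vector $x\in\mathbb{R}^n$ with $x\ge 0$, $q+\mathcal{A}x^{m-1}\ge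 0$ and $x^\top(q+\mathcal{A}x^{m-1})=0$. $x_+=(\max\{x_1,0\},\dots,\max\{x_n,0\})^\top$, $\|x\|_\infty=\max_i|x_i|$, and $\|x\|_p=(\sum_i|x_i|^p)^{1/p}$ for $p\ge 1$. $T_{\mathcal{A}}:\mathbb{R}^n\to\mathbb{R}^n$ is $T_{\mathcal{A}}(x)=\|x\|_2^{2-m}\mathcal{A}x^{m-1}$ for $x\ne 0$ and $T_{\mathcal{A}}(0)=0$. When $m$ is even, $F_{\mathcal{A}}:\mathbb{R}^n\to\mathbb{R}^n$ is $F_{\mathcal{A}}(x)=(\mathcal{A}x^{m-1})^{[\frac1{m-1}]}$, the componentwise real $(m-1)$-th root. For a continuous positively homogeneous operator $T$ on $\mathbb{R}^n$, $\|T\|_\infty:=\max_{\|x\|_\infty=1}\|T(x)\|_\infty$ and $\|T\|_p:=\max_{\|x\|_p=1}\|T(x)\|_p$. *)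

(* Defs.v *)
From HB Require Import structures.
From mathcomp Require Import all_boot all_order all_algebra.
From mathcomp Require Import all_classical all_reals all_analysis.

Set Implicit Arguments.
Unset Strict Implicit.
Unset Printing Implicit Defensive.

Import Order.TTheory GRing.Theory Num.Theory.
Import numFieldNormedType.Exports.

Local Open Scope classical_set_scope.
Local Open Scope ring_scope.

(* The tuple [:: i_1; ...; i_m] indexes the entry a_(i_1 ... i_m); indices run
   over {0, ..., n-1} instead of {1, ..., n}. *)
Definition tensor (R : realType) (m n : nat) := {ffun m.-tuple 'I_n -> R}.

(* A x^(m-1): for m >= 1, [ohead t == Some i] says that i_1 = i, and [behead t]
   is the list i_2, ..., i_m. *)
Definition tensor_apply (R : realType) (m n : nat) (A : tensor R m n)
    (x : 'cV[R]_n) : 'cV[R]_n :=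
  \col_(i < n) \sum_(t : m.-tuple 'I_n | ohead t == Some i)
    A t * \prod_(j <- behead t) x j 0.

Definition nonneg_vec (R : realType) (n : nat) (x : 'cV[R]_n) : Prop :=
  forall i : 'I_n, 0 <= x i 0.

Definition strictly_semi_positive (R : realType) (m n : nat)
    (A : tensor R m n) : Prop :=
  forall x : 'cV[R]_n, nonneg_vec x -> x <> 0 ->
    exists k : 'I_n, 0 < x k 0 /\ 0 < tensor_apply A x k 0.

Definition TCP_solution (R : realType) (m n : nat) (A : tensor R m n)
    (q x : 'cV[R]_n) : Prop :=
  [/\ nonneg_vec x,
      nonneg_vec (q + tensor_apply A x) &
      x^T *m (q + tensor_apply A x) = 0].

Definition pos_part (R : realType) (n : nat) (x : 'cV[R]_n) : 'cV[R]_n :=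
  \col_(i < n) Num.max (x i 0) 0.

(* The library norm on matrices is the maximum of the absolute values of the
   entries, see [norm_infE]. *)
Definition norm_inf (R : realType) (n : nat) (x : 'cV[R]_n) : R := `|x|.
Arguments norm_inf {R n} x.

Lemma norm_infE (R : realType) (n : nat) (x : 'cV[R]_n) :
  norm_inf x = \big[Num.max/0]_(i < n) `|x i 0|.
Proof.
rewrite /norm_inf /Num.norm /= mx_normrE; apply/le_anti/andP; split.
- apply/bigmax_leP; split=> [|[i j] _]; first exact: bigmax_ge_id.
  by rewrite /= (ord1 j) (le_bigmax _ (fun i => `|x i 0|)).
- apply/bigmax_leP; split=> [|i _]; first exact: bigmax_ge_id.
  exact: (le_bigmax _ (fun ij => `|x ij.1 ij.2|) (i, 0)).
Qed.

Definition norm_p (R : realType) (p : R) (n : nat) (x : 'cV[R]_n) : R :=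
  (\sum_(i < n) `|x i 0| `^ p) `^ p^-1.
Arguments norm_p {R} p {n} x.

(* Operator norm induced by N: for a continuous positively homogeneous T and
   N = norm_inf or N = norm_p p with p >= 1, in dimension n >= 1, the supremum
   over the unit sphere is attained, so it is the maximum. *)
Definition opnorm (R : realType) (n : nat) (N : 'cV[R]_n -> R)
    (T : 'cV[R]_n -> 'cV[R]_n) : R :=
  sup [set N (T x) | x in [set x : 'cV[R]_n | N x = 1]].

Definition T_op (R : realType) (m n : nat) (A : tensor R m n)
    (x : 'cV[R]_n) : 'cV[R]_n :=
  if x == 0 then 0
  else (norm_p 2 x) ^ (2%:Z - m%:Z) *: tensor_apply A x.

(* The real k-th root for odd k, see [odd_rootK]. *)
Definition odd_root (R : realType) (k : nat) (y : R) : R :=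
  Num.sg y * `|y| `^ (k%:R)^-1.

Lemma odd_rootK (R : realType) (k : nat) (y : R) :
  odd k -> odd_root k y ^+ k = y.
Proof.
move=> ok; have k0 : (0 < k)%N by case: k ok.
have [->|y0] := eqVneq y 0; first by rewrite /odd_root sgr0 mul0r expr0n gtn_eqF.
rewrite /odd_root exprMn sgr_odd // ok expr1 -powR_mulrn ?powR_ge0 //.
by rewrite -powRrM mulVf ?pnatr_eq0 -?lt0n // powRr1 // -numEsg.
Qed.

Definition F_op (R : realType) (m n : nat) (A : tensor R m n)
    (x : 'cV[R]_n) : 'cV[R]_n :=
  \col_(i < n) odd_root m.-1 (tensor_apply A x i 0).

(* Main.v *)
(* Feasibility q + A x^(m-1) >= 0 gives (-q)_+ <= |A x^(m-1)| componentwise, so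
   every norm N that is monotone in the absolute values of the entries satisfies
   N((-q)_+) <= N(A x^(m-1)).  For N = ||.||_inf or ||.||_2 the right-hand side
   is ||x||_2^(m-2) N(T x), with N(T x) <= ||T|| N(x) and
   ||x||_2 <= sqrt n ||x||_inf.  For F, raising to the power m-1 undoes the
   root; for N = ||.||_m this produces the norm of A x^(m-1) with exponent
   m/(m-1) <= m, which dominates the one with exponent m.  A vanishing operator
   norm is harmless because a / 0 = 0. *)
Require Import Defs.
From mathcomp Require Import all_boot all_order all_algebra.
From mathcomp Require Import all_classical all_reals all_analysis.

Set Implicit Arguments.
Unset Strict Implicit.
Unset Printing Implicit Defensive.

Import Order.TTheory GRing.Theory Num.Theory.
Local Open Scope ring_scope.

(** * Homogeneity and boundedness of A x^(m-1) *)

Section TensorApply.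
Context {R : realType} {m n : nat}.
Implicit Types (A : tensor R m n) (x : 'cV[R]_n) (t : R).

Lemma tensor_applyZ A t x : (0 < m)%N ->
  tensor_apply A (t *: x) = t ^+ m.-1 *: tensor_apply A x.
Proof.
move=> m0; apply/colP => i; rewrite !mxE mulr_sumr; apply: eq_bigr => s _.
rewrite mulrCA; congr (_ * _).
under eq_bigr do rewrite mxE.
by rewrite big_split big_const_seq count_predT size_behead size_tuple iter_mulr_1.
Qed.

Lemma tensor_apply0 A : (1 < m)%N -> tensor_apply A 0 = 0.
Proof.
move=> m1; have := @tensor_applyZ A 0 0 (ltnW m1).
by rewrite scale0r expr0n gtn_eqF ?scale0r // -subn1 subn_gt0.
Qed.

(** A crude bound: each monomial in entries of modulus at most 1 has modulus at most 1. It serves to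
    show that the sets whose [sup] defines [opnorm] are bounded above. *)
Lemma tensor_apply_le A x i : (forall j, `|x j 0| <= 1) ->
  `|tensor_apply A x i 0| <= \sum_t `|A t|.
Proof.
move=> x1; rewrite mxE (le_trans (ler_norm_sum _ _ _)) //.
rewrite big_mkcond ler_sum // => t _; case: ifP => // _.
rewrite normrM ler_piMr // normr_prod.
elim: (behead t) => [|j s IHs]; first by rewrite big_nil.
by rewrite big_cons mulr_ile1 ?prodr_ge0.
Qed.

End TensorApply.

(** A common interface for [norm_inf] and for [norm_p p] with p > 0, so that the operator bounds are
    proved once for all norms. *)
Record absolute_gauge (R : realType) (n : nat) (N : 'cV[R]_n -> R) : Prop :=
  AbsoluteGauge {
    gauge_ge : forall (x : 'cV_n) i, `|x i 0| <= N x;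
    gaugeZ : forall (t : R) x, 0 <= t -> N (t *: x) = t * N x;
    gauge_le : forall x y : 'cV_n, (forall i, `|x i 0| <= `|y i 0|) -> N x <= N y }.

(** * Operator norms with respect to an absolute gauge *)

Section AbsoluteGauge.
Context {R : realType} {n : nat} {N : 'cV[R]_n -> R} (hN : absolute_gauge N).

Lemma gauge0 : N 0 = 0.
Proof. by rewrite -(scale0r (0 : 'cV[R]_n)) gaugeZ // mul0r. Qed.

Lemma gauge_ge0 x : 0 <= N x.
Proof. by rewrite -gauge0 gauge_le // => i; rewrite mxE normr0. Qed.

Lemma gauge_gt0 x : x != 0 -> 0 < N x.
Proof.
move=> x0; rewrite lt_neqAle gauge_ge0 andbT; apply: contraNneq x0 => Nx0.
apply/eqP/colP => i; rewrite [RHS]mxE; apply/eqP.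
by rewrite -normr_le0 Nx0 gauge_ge.
Qed.

(** Scaling x to the unit sphere of N reduces the bound to a member of the set under [sup]. The
    entrywise bound C guarantees that this [sup] is a genuine upper bound, and x != 0 that the
    sphere has a point. *)
Lemma opnorm_le (T : 'cV[R]_n -> 'cV[R]_n) (C : R) x :
  (forall t y, 0 < t -> T (t *: y) = t *: T y) ->
  (forall y, N y = 1 -> forall i, `|T y i 0| <= C) ->
  x != 0 -> 0 <= opnorm N T /\ N (T x) <= opnorm N T * N x.
Proof.
move=> TZ TC x0; have Nx := gauge_gt0 x0.
set u := (N x)^-1 *: x.
have Nu : N u = 1 by rewrite gaugeZ ?invr_ge0 ?gauge_ge0 // mulVf ?gt_eqF.
have leu : N (T u) <= opnorm N T.
  apply: ub_le_sup; last by exists u.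
  (* Monotonicity of N turns the entrywise bound C into a bound on N (T y). *)
  exists (N (const_mx C)) => _ [y Ny <-].
  by apply: gauge_le => // i; rewrite mxE (le_trans (TC y Ny i)) ?ler_norm.
split; first exact: le_trans (gauge_ge0 _) leu.
rewrite -ler_pdivrMr // mulrC -gaugeZ ?invr_ge0 ?gauge_ge0 //.
by rewrite -TZ ?invr_gt0.
Qed.

Lemma gauge_pos_part_le (q y : 'cV[R]_n) :
  nonneg_vec (q + y) -> N (pos_part (- q)) <= N y.
Proof.
move=> qy; apply: gauge_le => // i; have := qy i; rewrite !mxE => qyi.
rewrite ger0_norm ?le_max ?lexx ?orbT // ge_max normr_ge0 andbT.
by rewrite (le_trans _ (ler_norm _)) // -subr_ge0 opprK addrC.
Qed.

End AbsoluteGauge.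

(** * The max norm and the p-norms, and comparisons between them *)

Section Norms.
Context {R : realType} {n : nat}.
Implicit Types x : 'cV[R]_n.

Lemma norm_inf_ge x i : `|x i 0| <= norm_inf x.
Proof. by rewrite norm_infE (le_bigmax _ (fun i => `|x i 0|)). Qed.

Lemma norm_inf_le x (C : R) :
  0 <= C -> (forall i, `|x i 0| <= C) -> norm_inf x <= C.
Proof. by move=> C0 xC; rewrite norm_infE; apply/bigmax_leP; split. Qed.

Lemma norm_inf_gauge : absolute_gauge (@norm_inf R n).
Proof.
split=> [|t x t0|x y xy]; first exact: norm_inf_ge.
- by rewrite /norm_inf normrZ ger0_norm.
- apply: norm_inf_le => [|i]; first exact: normr_ge0.
  exact: le_trans (xy i) (norm_inf_ge y i).
Qed.

Lemma norm_p_gauge (p : R) : 0 < p -> absolute_gauge (@norm_p R p n).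
Proof.
move=> p0; have pN0 : p != 0 by rewrite gt_eqF.
split=> [x i|t x t0|x y xy].
(* An entry is written as (|x_i|^p)^(1/p), so that it is compared under the root with the whole
   sum. *)
- rewrite -{1}[`|x i 0|]powRr1 // -(mulfV pN0) powRrM.
  rewrite ge0_ler_powR ?invr_ge0 ?nnegrE ?powR_ge0 ?(ltW p0) //.
    by apply: sumr_ge0 => j _; apply: powR_ge0.
  by rewrite (bigD1 i) //= lerDl sumr_ge0 // => j _; apply: powR_ge0.
- rewrite /norm_p; under eq_bigr do rewrite mxE normrM powRM // ger0_norm //.
  rewrite -mulr_sumr powRM ?powR_ge0 //; last first.
    by apply: sumr_ge0 => j _; apply: powR_ge0.
  by rewrite -powRrM mulfV // powRr1.
- rewrite /norm_p ge0_ler_powR ?invr_ge0 ?(ltW p0) ?nnegrE //.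
  + by apply: sumr_ge0 => j _; apply: powR_ge0.
  + by apply: sumr_ge0 => j _; apply: powR_ge0.
  + by apply: ler_sum => i _; rewrite ge0_ler_powR ?nnegrE ?(ltW p0).
Qed.

Lemma norm_p_powR (p : R) x : 0 < p ->
  norm_p p x `^ p = \sum_(i < n) `|x i 0| `^ p.
Proof.
move=> p0; rewrite /norm_p -powRrM mulVf ?gt_eqF // powRr1 //.
by apply: sumr_ge0 => j _; apply: powR_ge0.
Qed.

(** With s the p-norm of x, |x_i|^r = |x_i|^p |x_i|^(r-p) <= |x_i|^p s^(r-p), and summing over i
    gives s^r. *)
Lemma norm_p_anti (p r : R) x : 0 < p -> p <= r -> norm_p r x <= norm_p p x.
Proof.
move=> p0 pr; have r0 := lt_le_trans p0 pr.
have rN0 : r != 0 by rewrite gt_eqF.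
have Np := norm_p_gauge p0; set s := norm_p p x.
have s0 : 0 <= s by exact: gauge_ge0 Np x.
rewrite -[leRHS]powRr1 // -(mulfV rN0) powRrM.
rewrite ge0_ler_powR ?invr_ge0 ?(ltW r0) ?nnegrE ?powR_ge0 //.
  by apply: sumr_ge0 => j _; apply: powR_ge0.
have rE : r = p + (r - p) by rewrite addrC subrK.
have -> : s `^ r = \sum_(i < n) `|x i 0| `^ p * s `^ (r - p).
  (* Splitting a power whose base may be 0 requires a nonzero total exponent, here r. *)
  by rewrite -mulr_suml -norm_p_powR // -powRD -?rE ?(negPf rN0).
apply: ler_sum => i _.
rewrite {1}rE powRD -?rE ?(negPf rN0) //.
rewrite ler_wpM2l ?powR_ge0 // ge0_ler_powR ?subr_ge0 ?nnegrE //.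
exact: gauge_ge Np x i.
Qed.

Lemma norm_p2_le_inf x : norm_p 2 x <= n%:R `^ 2^-1 * norm_inf x.
Proof.
have Ninf := norm_inf_gauge; have x0 := gauge_ge0 Ninf x.
have -> : n%:R `^ 2^-1 * norm_inf x = (n%:R * norm_inf x `^ 2) `^ 2^-1.
  by rewrite powRM ?powR_ge0 // -powRrM mulfV ?pnatr_eq0 // powRr1.
rewrite ge0_ler_powR ?invr_ge0 ?nnegrE ?mulr_ge0 ?powR_ge0 //.
  by apply: sumr_ge0 => j _; apply: powR_ge0.
have -> : n%:R * norm_inf x `^ 2 = \sum_(i < n) norm_inf x `^ 2.
  by rewrite sumr_const card_ord mulr_natl.
apply: ler_sum => i _.
by rewrite ge0_ler_powR ?nnegrE // norm_inf_ge.
Qed.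

End Norms.

(** * The operators T and F: homogeneity, boundedness, relation to A x^(m-1) *)

Section Operators.
Context {R : realType} {m n : nat} (m2 : (2 <= m)%N) (A : tensor R m n).
Implicit Types x : 'cV[R]_n.

Let m0 : (0 < m)%N. Proof. exact: ltnW. Qed.

Let N2 : absolute_gauge (@norm_p R 2 n).
Proof. by apply: norm_p_gauge. Qed.

(** Since m >= 2, the integer power 2 - m is the inverse of a natural power. *)
Lemma T_opE x : x != 0 ->
  T_op A x = (norm_p 2 x ^+ (m - 2))^-1 *: tensor_apply A x.
Proof.
move=> x0; rewrite /T_op (negPf x0); congr (_ *: _).
by rewrite -opprB subzn // -exprnN.
Qed.

Lemma T_opZ (t : R) x : 0 < t -> T_op A (t *: x) = t *: T_op A x.
Proof.
move=> t0; have [->|x0] := eqVneq x 0.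
  by rewrite scaler0 /T_op eqxx scaler0.
have tx0 : t *: x != 0 by rewrite scaler_eq0 (gt_eqF t0).
have tN0 : t != 0 by rewrite gt_eqF.
rewrite !T_opE // tensor_applyZ // (gaugeZ N2) ?(ltW t0) // !scalerA.
congr (_ *: _); rewrite exprMn invfM mulrAC; congr (_ * _).
(* Of the m-1 factors t from A x^(m-1), the normalisation cancels m-2, leaving exactly one. *)
have -> : m.-1 = (m - 2).+1 by case: m m2 => [|[|k]] // _; rewrite subn2.
by rewrite exprS mulrCA mulVf ?mulr1 // expf_neq0.
Qed.

Lemma norm_T_op (N : 'cV[R]_n -> R) x : absolute_gauge N -> x != 0 ->
  N (tensor_apply A x) = norm_p 2 x ^+ (m - 2) * N (T_op A x).
Proof.
move=> hN x0; have x_gt0 := gauge_gt0 N2 x0.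
rewrite -(gaugeZ hN) ?exprn_ge0 ?(ltW x_gt0) // T_opE // scalerA.
by rewrite mulfV ?scale1r // expf_neq0 ?gt_eqF.
Qed.

(** On the unit sphere of N, the domination of N by the 2-norm gives ||x||_2 >= 1, so the factor
    ||x||_2^(2-m) is at most 1, while all entries of x have modulus at most 1. *)
Lemma T_op_le (N : 'cV[R]_n -> R) x : absolute_gauge N ->
  (forall y, N y <= norm_p 2 y) -> N x = 1 ->
  forall i, `|T_op A x i 0| <= \sum_t `|A t|.
Proof.
move=> hN N_le Nx i; have := N_le x; rewrite Nx => x2.
have x0 : x != 0.
  by apply: contra_eq_neq Nx => ->; rewrite (gauge0 hN) eq_sym oner_neq0.
have e0 : 0 <= norm_p 2 x ^+ (m - 2) by rewrite exprn_ge0 // (gauge_ge0 N2).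
rewrite T_opE // mxE normrM ger0_norm ?invr_ge0 //.
rewrite (le_trans (ler_piMl _ _)) ?invf_le1 ?exprn_ege1 //.
  by rewrite (lt_le_trans _ (exprn_ege1 _ x2)).
by apply: tensor_apply_le => j; rewrite -Nx gauge_ge.
Qed.

Lemma norm_odd_root (k : nat) (y : R) : (0 < k)%N ->
  `|odd_root k y| = `|y| `^ k%:R^-1.
Proof.
move=> k0; rewrite /odd_root normrM (ger0_norm (powR_ge0 _ _)) normr_sg.
(* At y = 0 the sign factor is 0; the right-hand side is 0 as well because the exponent 1/k is
   nonzero. *)
have [->|_] := eqVneq y 0; last by rewrite mul1r.
by rewrite mul0r normr0 powR0 // invr_eq0 pnatr_eq0 -lt0n.
Qed.

Lemma odd_rootM (k : nat) (t y : R) : (0 < k)%N -> 0 < t ->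
  odd_root k (t ^+ k * y) = t * odd_root k y.
Proof.
move=> k0 t0; have tk0 : 0 < t ^+ k by rewrite exprn_gt0.
rewrite /odd_root sgrM gtr0_sg // mul1r normrM (gtr0_norm tk0).
rewrite powRM ?(ltW tk0) // -powR_mulrn ?(ltW t0) // -powRrM.
by rewrite mulfV ?pnatr_eq0 -?lt0n // powRr1 ?(ltW t0) // mulrCA.
Qed.

Let k0 : (0 < m.-1)%N. Proof. by rewrite -ltnS prednK. Qed.

Lemma F_opE x i : F_op A x i 0 = odd_root m.-1 (tensor_apply A x i 0).
Proof. by rewrite mxE. Qed.

Lemma F_opZ (t : R) x : 0 < t -> F_op A (t *: x) = t *: F_op A x.
Proof.
move=> t0; apply/colP => i.
by rewrite [RHS]mxE !F_opE tensor_applyZ // [X in odd_root _ X]mxE odd_rootM.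
Qed.

Lemma F_op_le (N : 'cV[R]_n -> R) x : absolute_gauge N -> N x = 1 ->
  forall i, `|F_op A x i 0| <= (\sum_t `|A t|) `^ m.-1%:R^-1.
Proof.
move=> hN Nx i; rewrite F_opE norm_odd_root // ge0_ler_powR ?invr_ge0 ?nnegrE //.
  by rewrite sumr_ge0.
by apply: tensor_apply_le => j; rewrite -Nx gauge_ge.
Qed.

Lemma F_op_pow x i : ~~ odd m -> F_op A x i 0 ^+ m.-1 = tensor_apply A x i 0.
Proof. by move=> om; rewrite F_opE odd_rootK // -[odd _]negbK -oddS prednK. Qed.

Lemma norm_inf_F_op x : ~~ odd m ->
  norm_inf (tensor_apply A x) <= norm_inf (F_op A x) ^+ m.-1.
Proof.
have F0 : 0 <= norm_inf (F_op A x) by exact: normr_ge0.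
move=> om; apply: norm_inf_le => [|i]; first exact: exprn_ge0.
by rewrite -F_op_pow // normrX lerXn2r ?nnegrE // norm_inf_ge.
Qed.

Lemma norm_p_F_op x :
  norm_p m%:R (tensor_apply A x) <= norm_p m%:R (F_op A x) ^+ m.-1.
Proof.
have mR : 0 < m%:R :> R by rewrite ltr0n.
have kR : 0 < m.-1%:R :> R by rewrite ltr0n.
have p0 : 0 < m.-1%:R^-1 * m%:R :> R by rewrite mulr_gt0 ?invr_gt0.
(* Passing to the smaller exponent m/(m-1) makes the two sides equal: |F_i|^m = |(A
   x^(m-1))_i|^(m/(m-1)), and both outer exponents are (m-1)/m. *)
apply: le_trans (norm_p_anti _ p0 _) _.
  by rewrite ler_piMl ?(ltW mR) // invf_le1 // ler1n.
rewrite -powR_mulrn; last exact: gauge_ge0 (norm_p_gauge mR) _.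
rewrite /norm_p -powRrM invfM invrK [m%:R^-1 * _]mulrC.
under [in leRHS]eq_bigr do rewrite F_opE norm_odd_root // -powRrM.
by rewrite lexx.
Qed.

End Operators.

Theorem theorem3p11 (R : realType) (m n : nat) (hm : (2 <= m)%N)
    (hn : (1 <= n)%N) (A : tensor R m n) (hA : strictly_semi_positive A)
    (q x : 'cV[R]_n) (hx : TCP_solution A q x) :
  [/\ norm_inf (pos_part (- q)) /
        (n%:R `^ ((m%:R - 2) / 2) * opnorm norm_inf (T_op A))
        <= norm_inf x ^+ (m - 1),
      ~~ odd m ->
        norm_inf (pos_part (- q)) / opnorm norm_inf (F_op A) ^+ (m - 1)
        <= norm_inf x ^+ (m - 1),
      norm_p 2 (pos_part (- q)) / opnorm (norm_p 2) (T_op A)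
        <= norm_p 2 x ^+ (m - 1) &
      ~~ odd m ->
        norm_p m%:R (pos_part (- q)) /
          opnorm (norm_p m%:R) (F_op A) ^+ (m - 1)
        <= norm_p m%:R x ^+ (m - 1)].
Proof.
case: hx => _ qAx _; have m0 : (0 < m)%N by apply: ltnW.
have mR : 0 < m%:R :> R by rewrite ltr0n.
have Ninf := @norm_inf_gauge R n.
have N2 : absolute_gauge (@norm_p R 2 n) by apply: norm_p_gauge.
have Nm := norm_p_gauge mR (n := n).
(* The zero vector cannot be normalised; there feasibility reads q >= 0, so (-q)_+ = 0 and every
   left-hand side vanishes. *)
have [x0|x0] := eqVneq x 0.
  have q0 : pos_part (- q) = 0.
    apply/colP => i; have := qAx i; rewrite x0 tensor_apply0 // addr0 !mxE => qi.
    by rewrite max_r // oppr_le0.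
  rewrite q0 !gauge0 // !mul0r.
  by split=> [|_||_]; rewrite exprn_ge0 ?gauge_ge0.
have div_le (a b c : R) : 0 <= b -> 0 <= c -> a <= c * b -> a / b <= c.
  move=> b0 c0 ab; have [->|bN0] := eqVneq b 0; first by rewrite invr0 mulr0.
  by rewrite ler_pdivrMr // lt_neqAle eq_sym bN0.
have qA N : absolute_gauge N -> N (pos_part (- q)) <= N (tensor_apply A x).
  by move=> hN; apply: gauge_pos_part_le.
have expS : (m - 1 = (m - 2).+1)%N by rewrite -subSn.
(* This is the domination by the 2-norm that bounds T on the unit sphere of the max norm. *)
have inf_le2 (y : 'cV[R]_n) : norm_inf y <= norm_p 2 y.
  by apply: norm_inf_le => [|i]; [exact: gauge_ge0 N2 _ | exact: gauge_ge N2 _ _].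
have F_bound N (hN : absolute_gauge N) :=
  opnorm_le hN (F_opZ hm A) (fun y => @F_op_le _ _ _ hm A N y hN) x0.
have [Tinf0 Tinf] := opnorm_le Ninf (T_opZ hm A)
  (fun y => T_op_le hm A Ninf inf_le2) x0.
have [T20 T2] := opnorm_le N2 (T_opZ hm A)
  (fun y => T_op_le hm A N2 (fun=> lexx _)) x0.
have [Finf0 Finf] := F_bound _ Ninf.
have [Fm0 Fm] := F_bound _ Nm.
split=> [|om||om]; apply: div_le;
  rewrite ?mulr_ge0 ?exprn_ge0 ?powR_ge0 ?gauge_ge0 //.
- apply: le_trans (qA _ Ninf) _; rewrite (norm_T_op hm A Ninf x0) expS exprSr.
  have -> : n%:R `^ ((m%:R - 2) / 2) = (n%:R `^ 2^-1) ^+ (m - 2) :> R.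
    by rewrite -powR_mulrn ?powR_ge0 // -powRrM [2^-1 * _]mulrC natrB.
  (* The right-hand side is regrouped as (sqrt n ||x||_inf)^(m-2) times ||T||_inf ||x||_inf, to be
     compared factor by factor with ||x||_2^(m-2) and ||T x||_inf. *)
  rewrite mulrACA -exprMn [norm_inf x * opnorm _ _]mulrC.
  rewrite [norm_inf x * _]mulrC.
  rewrite ler_pM ?exprn_ge0 ?gauge_ge0 // lerXn2r ?norm_p2_le_inf //.
    by rewrite nnegrE gauge_ge0.
  by rewrite nnegrE mulr_ge0 ?powR_ge0 ?gauge_ge0.
- apply: le_trans (qA _ Ninf) (le_trans (norm_inf_F_op hm A x om) _).
  by rewrite subn1 -exprMn lerXn2r ?nnegrE ?mulr_ge0 ?gauge_ge0 // mulrC.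
- apply: le_trans (qA _ N2) _; rewrite (norm_T_op hm A N2 x0) expS exprSr.
  by rewrite -mulrA ler_wpM2l ?exprn_ge0 ?gauge_ge0 // mulrC.
- apply: le_trans (qA _ Nm) (le_trans (norm_p_F_op hm A x) _).
  by rewrite subn1 -exprMn lerXn2r ?nnegrE ?mulr_ge0 ?gauge_ge0 // mulrC.
Qed.
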